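(* Let $\Bbbk$ be an algebraically closed field, let $n,m\ge 0$ be integers, and let $n_0,\ldots,n_m\geq 0$ be integers. For $j=0,\ldots,m$ let $$f_j(x_0,\ldots,x_n)=\sum_{s_0+\cdots+s_n=n_j}a_{j,s_0,\ldots,s_n}\,x_0^{s_0}\cdots x_n^{s_n}$$ be a homogeneous polynomial of degree $n_j$ with coefficients in $\Bbbk$. Fix positive integers $m_i$ ($0\le i\le n$) and $k_{ij}$ ($0\le i\le n$, $0\le j\le m$) such that $m_i=k_{ij}+n_j$ for all $i,j$. Let $$A_{ij}(x_0,\ldots,x_n)=\sum_{s_0+\cdots+s_n=k_{ij}}b_{i,j,s_0,\ldots,s_n}\,x_0^{s_0}\cdots x_n^{s_n}$$ be homogeneous polynomials of degree $k_{ij}$ with indeterminate coefficients $b_{i,j,s_0,\ldots,s_n}$. Then the system $f_0(x)=\cdots=f_m(x)=0$ has a non-zero solution $x\in\Bbbk^{n+1}$ if and only if $$R\Big(\sum_{j=0}^m A_{0j}f_j,\ \sum_{j=0}^m A_{1j}f_j,\ \ldots,\ \sum_{j=0}^m A_{nj}f_j\Big)\equiv 0$$ as a polynomial in the indeterminates $b_{i,j,s_0,\ldots,s_n}$, where $R$ is the resultant of $n+1$ forms in $n+1$ variables of degrees $m_0,\ldots,m_n$. Thus the coefficients of this polynomial in the $b_{i,j,s_0,\ldots,s_n}$, regarded as polynomials in the $a_{j,s_0,\ldots,s_n}$, form a system of resultants of $f_0,\ldots,f_m$.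
   Context: Resultant: for positive integers $d_0,\ldots,d_n$, the resultant $R(g_0,\ldots,g_n)$ of $n+1$ homogeneous polynomials $g_0,\ldots,g_n$ in the variables $x_0,\ldots,x_n$, of degrees $d_0,\ldots,d_n$, is the irreducible polynomial with integer coefficients in the coefficients of the $g_i$ such that, for $g_i$ with coefficients in an algebraically closed field, the system $g_0=\cdots=g_n=0$ has a non-zero solution if and only if $R(g_0,\ldots,g_n)=0$. (The existence of $R$ is a classical fact.) System of resultants: for forms $f_0,\ldots,f_m$ in $x_0,\ldots,x_n$ of fixed degrees with coefficients $a_{j,s_0,\ldots,s_n}$, a system of resultants is a finite set of polynomials $R_l(a)$ with integer coefficients in the $a_{j,s_0,\ldots,s_n}$ such that the system $f_0=\cdots=f_m=0$ has a non-zero solution in $\Bbbk^{n+1}$ if and only if $R_l(a)=0$ for all $l$ (only this set-theoretic condition is required). *)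

(* Defs.v *)
From mathcomp Require Import all_boot all_order all_algebra.
From mathcomp.multinomials Require Import mpoly.

Set Implicit Arguments.
Unset Strict Implicit.
Unset Printing Implicit Defensive.

Import GRing.Theory.
Local Open Scope ring_scope.

(* Exponent vectors of total degree exactly [d]; the bound [d.+1] only serves
   to obtain a finite type. *)
Definition expo (N d : nat) : finType := {s : 'X_{1..N < d.+1} | mdeg s == d}.

Definition expo_mnm N d (s : expo N d) : 'X_{1..N} := bmnm (val s).

(* Names of the coefficients of a family of forms of degrees [d i] in [N]
   variables: the name [Tagged _ s] with tag [i] stands for the coefficient of
   x^s in the [i]-th form. *)
Definition cname (N : nat) (I : finType) (d : I -> nat) : finType :=
  {i : I & expo N (d i)}.

Arguments cname N {I} d.

(* Polynomials over S in variables indexed by a finite type [T], the variable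
   [t : T] being number [enum_rank t]. *)
Notation fpoly S T := {mpoly S[#|{: T}|]}.

Definition fvar (S : comNzRingType) (T : finType) (t : T) : fpoly S T :=
  'X_(enum_rank t).

Definition feval (S : comNzRingType) (T : finType) (P : fpoly int T)
  (v : T -> S) : S :=
  (map_mpoly intr P).@[fun k => v (enum_val k)].

Definition coeffs (S : comNzRingType) (N : nat) (I : finType) (d : I -> nat)
  (g : I -> {mpoly S[N]}) : cname N d -> S :=
  fun t => (g (tag t))@_(expo_mnm (tagged t)).
Arguments coeffs {S N I} d g t.

Definition generic_form (S : comNzRingType) (N : nat) (I : finType)
  (d : I -> nat) (i : I) : {mpoly (fpoly S (cname N d))[N]} :=
  \sum_(s : expo N (d i))
     fvar S (Tagged (fun i => expo N (d i)) s : cname N d) *: 'X_[expo_mnm s].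

Arguments generic_form S N {I} d i.

Definition has_nonzero_solution (F : fieldType) (N : nat) (I : finType)
  (g : I -> {mpoly F[N]}) : Prop :=
  exists x : 'I_N -> F, (exists i, x i != 0) /\ (forall i, (g i).@[x] = 0).

Definition irreducible_elt (D : idomainType) (p : D) : Prop :=
  [/\ p != 0, p \isn't a GRing.unit &
      forall q r : D, p = q * r ->
        (q \is a GRing.unit) \/ (r \is a GRing.unit)].

(* These conditions determine the resultant up to sign. *)
Definition is_resultant (n : nat) (d : 'I_n.+1 -> nat)
  (R : fpoly int (cname n.+1 d)) : Prop :=
  irreducible_elt R /\
  forall (F : closedFieldType) (g : 'I_n.+1 -> {mpoly F[n.+1]}),
    (forall i, g i \is (d i).-homog) ->
    (has_nonzero_solution g <-> feval R (coeffs d g) = 0).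

Definition is_system_of_resultants (F : closedFieldType) (n m : nat)
  (d : 'I_m.+1 -> nat) (Rs : seq (fpoly int (cname n.+1 d))) : Prop :=
  forall f : 'I_m.+1 -> {mpoly F[n.+1]},
    (forall j, f j \is (d j).-homog) ->
    (has_nonzero_solution f <->
       (forall Rl, Rl \in Rs -> feval Rl (coeffs d f) = 0)).

(* Degrees of the forms A_ij, and names of their coefficients b_{i,j,s}. *)
Definition Adeg (n m : nat) (kk : 'I_n.+1 -> 'I_m.+1 -> nat)
  (ij : 'I_n.+1 * 'I_m.+1) : nat := kk ij.1 ij.2.

Definition bname (n m : nat) (kk : 'I_n.+1 -> 'I_m.+1 -> nat) : finType :=
  cname n.+1 (Adeg kk).

Definition Aform (n m : nat) (kk : 'I_n.+1 -> 'I_m.+1 -> nat)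
  (S : comNzRingType) (i : 'I_n.+1) (j : 'I_m.+1) :
  {mpoly (fpoly S (bname kk))[n.+1]} := generic_form S n.+1 (Adeg kk) (i, j).

(* sum_j A_ij f_j, with coefficients in S[b] *)
Definition Acomb (n m : nat) (kk : 'I_n.+1 -> 'I_m.+1 -> nat)
  (S : comNzRingType) (f : 'I_m.+1 -> {mpoly S[n.+1]}) (i : 'I_n.+1) :
  {mpoly (fpoly S (bname kk))[n.+1]} :=
  \sum_(j < m.+1) Aform kk S i j * map_mpoly (@mpolyC #|bname kk| S) (f j).

(* R(sum_j A_0j f_j, ..., sum_j A_nj f_j), as a polynomial in the b's *)
Definition res_comb (n m : nat) (kk : 'I_n.+1 -> 'I_m.+1 -> nat)
  (mm : 'I_n.+1 -> nat) (R : fpoly int (cname n.+1 mm))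
  (S : comNzRingType) (f : 'I_m.+1 -> {mpoly S[n.+1]}) :
  fpoly S (bname kk) :=
  feval R (coeffs mm (Acomb kk f)).

(* The coefficients of the above polynomial in the b's, as polynomials in the
   indeterminate coefficients a_{j,s} of forms f_j of degrees [nn j]. *)
Definition res_comb_coeffs (n m : nat) (kk : 'I_n.+1 -> 'I_m.+1 -> nat)
  (mm : 'I_n.+1 -> nat) (R : fpoly int (cname n.+1 mm))
  (nn : 'I_m.+1 -> nat) : seq (fpoly int (cname n.+1 nn)) :=
  let P := res_comb kk R (generic_form int n.+1 nn) in
  [seq P@_t | t <- msupp P].

(* Main.v *)
Require Import Defs.
From mathcomp Require Import all_boot all_order all_algebra.
From mathcomp.multinomials Require Import mpoly.

Set Implicit Arguments.
Unset Strict Implicit.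
Unset Printing Implicit Defensive.

Import GRing.Theory.
Local Open Scope ring_scope.

(* Since K is infinite, it suffices to evaluate R at specializations of the b's
   in K; so if the f_j have no common zero, coefficients b must be found for
   which the forms sum_j A_ij f_j have only the zero solution.  This is a
   dimension count.  A non-zero common zero x of these forms has some x_p <> 0,
   normalized to 1, and f_j(x) <> 0 for some j; solving the i-th equation for the
   coefficient of x_p^(k_ij) in A_ij writes all the b's as rational functions of
   the n remaining x's and of all but n+1 of the b's.  Hence the bad b's are
   covered by finitely many images of rational maps with one parameter fewer
   than there are b's.  Each image lies in a hypersurface, because N rational
   functions in fewer than N variables are algebraically dependent, and a
   finite union of hypersurfaces does not fill the affine space over K. *)

(** * Non-vanishing of polynomials over an algebraically closed field *)

Lemma horner_muni (S : comNzRingType) (n : nat) (p : {mpoly S[n.+1]})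
    (v : 'I_n.+1 -> S) :
  (map_poly (meval (v \o widen_ord (leqnSn n))) (muni p)).[v ord_max] = p.@[v].
Proof.
rewrite muniE mevalE rmorph_sum /= horner_sum; apply: eq_bigr => m _.
rewrite map_polyZ map_polyXn hornerZ hornerXn /= mevalZ mevalX big_ord_recr /=.
by rewrite mulrA; congr (_ * _ * _); apply: eq_bigr => i _; rewrite mnmE.
Qed.

(** No two monomials of [p] merge in [muni p]: the last exponent becomes the degree, and the others
    form the monomial inside the coefficient. *)
Lemma muni_eq0 (S : comNzRingType) (n : nat) (p : {mpoly S[n.+1]}) :
  muni p = 0 -> p = 0.
Proof.
move=> p0; apply/mpolyP => m; rewrite mcoeff0; apply/eqP/negPn/negP => pm.
have: ((muni p)`_(m ord_max))@_[multinom m (widen_ord (leqnSn n) i) | i < n]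
        = p@_m.
  rewrite muniE coef_sum raddf_sum /= (bigD1_seq m) ?mcoeff_msupp //=.
  rewrite big1 => [|k neq_km].
    by rewrite addr0 coefZ coefXn eqxx mulr1 mcoeffZ mcoeffX eqxx mulr1.
  rewrite coefZ coefXn; case: eqP => [eq_max|]; last by rewrite mulr0 mcoeff0.
  rewrite mulr1 mcoeffZ mcoeffX; case: eqP => [/mnmP eq_w|]; last by rewrite mulr0.
  case/eqP: neq_km; apply/mnmP => i.
  case: (unliftP ord_max i) => [j|] -> //.
  have ->: lift ord_max j = widen_ord (leqnSn n) j.
    by apply: val_inj; rewrite /= /bump leqNgt ltn_ord.
  by have := eq_w j; rewrite !mnmE.
by rewrite p0 coef0 mcoeff0 => /esym/eqP; apply/negP.
Qed.

(** Induction on [n]: choose the first coordinates so that the leading coefficient in the last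
    variable survives, then a non-root of the resulting univariate polynomial. *)
Lemma exists_meval_neq0 (K : closedFieldType) (n : nat) (p : {mpoly K[n]}) :
  p != 0 -> exists v, p.@[v] != 0.
Proof.
elim: n p => [|n IHn] p p_neq0.
  exists (fun=> 0); move: p_neq0; rewrite -(mpolyKC p) mevalC.
  by apply: contraNneq => ->; rewrite mpolyC0.
have /IHn[v v_neq0] : lead_coef (muni p) != 0.
  by rewrite lead_coef_eq0; apply: contra_neq p_neq0 => /muni_eq0.
have /closed_nonrootP[x] : map_poly (meval v) (muni p) != 0.
  apply: contra_neq v_neq0 => /(congr1 (fun q : {poly K} => q`_(size (muni p)).-1)).
  by rewrite coef_map coef0.
pose w i := if unlift ord_max i is Some j then v j else x.
rewrite /root -{1}[x](_ : w ord_max = x); last by rewrite /w unlift_none.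
move=> px; exists w; rewrite -horner_muni; move: px; congr (_.[_] != 0).
apply/polyP => j; rewrite !coef_map /=; apply: meval_eq => i /=.
have ->: widen_ord (leqnSn n) i = lift ord_max i.
  by apply: val_inj; rewrite /= /bump leqNgt ltn_ord.
by rewrite /w liftK.
Qed.

(** * Linear and algebraic dependence by counting monomials *)

Lemma leq_card_bmultinom (M L : nat) : (#|{: 'X_{1..M < L}}| <= L ^ M)%N.
Proof.
have lt_mL (m : 'X_{1..M < L}) i : (m i < L)%N.
  by apply: leq_ltn_trans (bmdeg m); rewrite mdegE (bigD1 i) //= leq_addr.
pose f (m : 'X_{1..M < L}) := [ffun i : 'I_M => Ordinal (lt_mL m i)].
have f_inj : injective f.
  move=> m1 m2 /ffunP eq_f; apply/val_inj/mnmP => i.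
  by have := eq_f i; rewrite !ffunE => /(congr1 val).
by have := leq_card f f_inj; rewrite card_ffun !card_ord.
Qed.

(** The coefficient matrix of the [E a] has more rows than columns, so a non-zero row of its left
    kernel gives [u]. *)
Lemma linear_dependence (K : fieldType) (M L : nat) (A : finType)
    (E : A -> {mpoly K[M]}) :
  (forall a, msize (E a) <= L)%N -> (L ^ M < #|A|)%N ->
  exists2 u : A -> K, exists a, u a != 0 & \sum_a u a *: E a = 0.
Proof.
move=> leEL ltA; have := leq_ltn_trans (leq_card_bmultinom M L) ltA => {}ltA.
pose B := \matrix_(i < #|A|, j < #|{: 'X_{1..M < L}}|)
            (E (enum_val i))@_(enum_val j : 'X_{1..M < L}).
have kerB_neq0 : kermx B != 0.
  rewrite -mxrank_eq0 mxrank_ker subn_eq0 -ltnNge.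
  exact: leq_ltn_trans (rank_leq_col B) ltA.
pose r := nz_row (kermx B).
have rB : r *m B = 0 by apply/sub_kermxP/nz_row_sub.
exists (fun a => r 0 (enum_rank a)).
  have /rV0Pn[j rj] : r != 0 by rewrite nz_row_eq0.
  by exists (enum_val j); rewrite enum_valK.
apply/mpolyP => m; rewrite mcoeff0 raddf_sum /=.
have [ltm|lem] := ltnP (mdeg m) L; last first.
  apply: big1 => a _; rewrite mcoeffZ memN_msupp_eq0 ?mulr0 //.
  by apply: msize_mdeg_ge; apply: leq_trans (leEL a) lem.
transitivity ((r *m B) 0 (enum_rank (BMultinom ltm))); last by rewrite rB mxE.
rewrite mxE (reindex (fun i : 'I_#|A| => enum_val i)) /=; last first.
  by exists enum_rank => ? _; rewrite ?enum_valK ?enum_rankK.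
by apply: eq_bigr => i _; rewrite mcoeffZ mxE !enum_rankK enum_valK.
Qed.

Lemma msize_prod_leq (D : idomainType) (M : nat) (I : Type) (r : seq I)
    (F : I -> {mpoly D[M]}) (d : I -> nat) :
  (forall i, msize (F i) <= (d i).+1)%N ->
  (msize (\prod_(i <- r) F i) <= (\sum_(i <- r) d i).+1)%N.
Proof.
move=> leF; elim: r => [|i r IHr]; first by rewrite !big_nil msize1.
rewrite !big_cons; set p := \prod_(_ <- _) _ in IHr *.
have [->|F_neq0] := eqVneq (F i) 0; first by rewrite mul0r msize0.
have [->|p_neq0] := eqVneq p 0; first by rewrite mulr0 msize0.
rewrite msizeM //; apply: leq_trans (_ : ((d i).+1 + (\sum_(j <- r) d j).+1).-1 <= _)%N.
  by rewrite -!subn1 leq_sub2r // leq_add.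
by rewrite addnS addSn.
Qed.

Lemma msizeX_leq (D : idomainType) (M : nat) (p : {mpoly D[M]}) (e k : nat) :
  (msize p <= e.+1)%N -> (msize (p ^+ k) <= (e * k).+1)%N.
Proof.
move=> lep.
have := @msize_prod_leq D M 'I_k (index_enum _) (fun=> p) (fun=> e) (fun=> lep).
by rewrite prodr_const sum_nat_const card_ord mulnC.
Qed.

(* [y i] is the value of [P i / H i].  Multiplied by [\prod_i H i ^+ D], the
   [D ^ N] monomials of partial degrees [< D] in the fractions become polynomials
   of degree less than [D * c] in [M] variables, and [(D * c) ^ M < D ^ N]. *)
Lemma algebraic_dependence (K : fieldType) (M N : nat)
    (P H : 'I_N -> {mpoly K[M]}) : (M < N)%N ->
  exists2 Q : {mpoly K[N]}, Q != 0 &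
    forall (v : 'I_M -> K) (y : 'I_N -> K),
      (forall i, (H i).@[v] != 0 /\ y i * (H i).@[v] = (P i).@[v]) ->
      Q.@[y] = 0.
Proof.
move=> ltMN.
pose e := (\max_i maxn (msize (P i)) (msize (H i)))%N.
have leP i : (msize (P i) <= e.+1)%N.
  by rewrite ltnW // ltnS (leq_trans (leq_maxl _ (msize (H i)))) // leq_bigmax.
have leH i : (msize (H i) <= e.+1)%N.
  by rewrite ltnW // ltnS (leq_trans (leq_maxr (msize (P i)) _)) // leq_bigmax.
(* [D] exceeds [c ^ M], whence (D * c)^M < D^(M+1) <= D^N; the successor in [c] absorbs the
   off-by-one of [msize] in [leE]. *)
pose c := (N * e).+1; pose D := (c ^ M).+1.
pose E (t : {ffun 'I_N -> 'I_D}) := \prod_i (P i ^+ t i * H i ^+ (D - t i)).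
have leE t : (msize (E t) <= (D * c))%N.
  apply: leq_trans (_ : (\sum_(i < N) e * D).+1 <= _)%N.
    apply: msize_prod_leq => i; set p := _ ^+ _; set q := _ ^+ _.
    have := @msize_prod_leq K M bool [:: true; false] (fun b => if b then p else q)
       (fun b => if b then (e * t i)%N else (e * (D - t i))%N).
    rewrite !big_cons !big_nil mulr1 addn0 -mulnDr subnKC.
      by apply; case; apply: msizeX_leq; [apply: leP|apply: leH].
    exact: ltnW (ltn_ord (t i)).
  by rewrite sum_nat_const card_ord /c mulnS (mulnC D) mulnA -add1n leq_add2r.
have [|u [t0 ut0] uE] := linear_dependence leE.
  rewrite card_ffun !card_ord expnMn.
  apply: leq_trans (_ : D ^ M.+1 <= _)%N; last by rewrite leq_exp2l // ltnS expn_gt0.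
  by rewrite expnSr ltn_pmul2l ?expn_gt0.
pose mon (t : {ffun 'I_N -> 'I_D}) : 'X_{1..N} := [multinom t i : nat | i < N].
have mon_inj : injective mon.
  move=> t1 t2 /mnmP eq_t; apply/ffunP => i; apply/val_inj.
  by have := eq_t i; rewrite !mnmE.
exists (\sum_t u t *: 'X_[mon t]).
  apply/eqP => /(congr1 (mcoeff (mon t0))); rewrite mcoeff0 raddf_sum /=.
  rewrite (bigD1 t0) //= big1 => [|t neq_t]; last first.
    by rewrite mcoeffZ mcoeffX (inj_eq mon_inj) (negPf neq_t) mulr0.
  by rewrite addr0 mcoeffZ mcoeffX eqxx mulr1; apply/eqP.
move=> v y Hy.
(* Clearing denominators turns [Q.@[y]] into the value at [v] of the relation [uE]. *)
have HD_neq0 : \prod_i (H i).@[v] ^+ D != 0.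
  by apply/prodf_neq0 => i _; rewrite expf_neq0 //; case: (Hy i).
apply: (mulIf HD_neq0); rewrite mul0r -[RHS](meval0 v) -uE.
rewrite !raddf_sum mulr_suml /=; apply: eq_bigr => t _.
rewrite !mevalZ mevalX rmorph_prod -mulrA -big_split /=; congr (_ * _).
apply: eq_bigr => i _; rewrite mnmE rmorphM !rmorphXn /= -(proj2 (Hy i)).
by rewrite exprMn -mulrA -exprD subnKC // ltnW ?ltn_ord.
Qed.

(** * Dimension count for the bad coefficients *)

Lemma dhomog_meval_scale (S : comNzRingType) (n d : nat) (p : {mpoly S[n]})
    (c : S) (x : 'I_n -> S) :
  p \is d.-homog -> p.@[fun i => c * x i] = c ^+ d * p.@[x].
Proof.
move=> /dhomogP p_hom; rewrite !mevalE mulr_sumr !big_seq.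
apply: eq_bigr => m /p_hom m_d; rewrite mulrCA; congr (_ * _).
rewrite -(m_d : mdeg m = d) mdegE -prodrXr -big_split /=.
by apply: eq_bigr => i _; rewrite exprMn.
Qed.

(* If [x p = 1] and [G (s i)] does not vanish at [x], then the equation of index
   [i] expresses [b (s i)] as a rational function of the other coefficients and
   of [x].  Giving the slot of the eliminated [b (s i)] to [x i], and dropping
   the slot of [x p = 1], leaves [#|T|.-1] parameters for [#|T|] coefficients. *)
Lemma chart_equation (K : fieldType) (n : nat) (T : finType)
    (pr : T -> 'I_n.+1) (G : T -> {mpoly K[n.+1]}) (s : 'I_n.+1 -> T)
    (p : 'I_n.+1) :
    (forall i, pr (s i) = i) ->
  exists2 Q : {mpoly K[#|T|]}, Q != 0 &
    forall (b : T -> K) (x : 'I_n.+1 -> K),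
      x p = 1 -> (forall i, (G (s i)).@[x] != 0) ->
      (forall i, \sum_(t | pr t == i) b t * (G t).@[x] = 0) ->
      Q.@[b \o enum_val] = 0.
Proof.
move=> prs.
pose r := enum_rank (s p).
(* [Y t] is the parameter in the slot of [t]; the dropped slot, that of [s p], holds the constant 1
   = x_p. *)
pose Y t : {mpoly K[#|T|.-1]} := oapp (fun k => 'X_k) 1 (unlift r (enum_rank t)).
pose X := [tuple Y (s i) | i < n.+1].
pose sel t := t == s (pr t).
(* For a selected [t], the fraction P t / H t solves equation [pr t] for [b t]; for any other [t] it
   is the parameter itself. *)
pose H t := if sel t then G t \mPo X else 1.
pose P t := if sel t
  then - \sum_(u | (pr u == pr t) && (u != t)) Y u * (G u \mPo X) else Y t.
have ltT : (#|T|.-1 < #|T|)%N by rewrite ltn_predL; apply/card_gt0P; exists (s p).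
have [Q Q_neq0 QE] := algebraic_dependence (P \o enum_val) (H \o enum_val) ltT.
exists Q => // b x xp Gx eqs.
pose w t := if sel t then x (pr t) else b t.
pose v k := w (enum_val (lift r k)).
have evalY t : (Y t).@[v] = w t.
  rewrite /Y; case: unliftP => [k|] /= eq_t.
    by rewrite mevalXU /v -eq_t enum_rankK.
  by rewrite meval1 (enum_rank_inj eq_t) /w /sel prs eqxx.
have evalG t : (G t \mPo X).@[v] = (G t).@[x].
  rewrite comp_mpoly_meval; apply: meval_eq => i.
  by rewrite tnth_mktuple evalY /w /sel prs eqxx.
apply: (QE v) => k /=; move: (enum_val k) => t {k}; rewrite /P /H.
case: ifP => [sel_t|nsel_t]; last by rewrite meval1 mulr1 oner_eq0 evalY /w nsel_t.
rewrite evalG; split; first by rewrite (eqP sel_t).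
have := eqs (pr t); rewrite (bigD1 t) //= => /eqP; rewrite addr_eq0 => /eqP ->.
rewrite mevalN; congr (- _); rewrite raddf_sum /=.
apply: eq_bigr => u /andP[/eqP pr_u neq_ut].
by rewrite mevalM evalG evalY /w /sel pr_u -(eqP sel_t) (negPf neq_ut).
Qed.

(** A chart is a choice of one index in each fibre of [pr], together with a coordinate [p]. There
    are finitely many, and [b] is taken where the product of their polynomials [Q] does not
    vanish. *)
Lemma exists_generic_combination (K : closedFieldType) (n : nat) (T : finType)
    (pr : T -> 'I_n.+1) (G : T -> {mpoly K[n.+1]}) (d : 'I_n.+1 -> nat) :
    (forall t, G t \is (d (pr t)).-homog) ->
  exists b : T -> K, forall x : 'I_n.+1 -> K, (exists p, x p != 0) ->
    (forall i, (\sum_(t | pr t == i) b t *: G t).@[x] = 0) ->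
    exists i, forall t, pr t = i -> (G t).@[x] = 0.
Proof.
move=> G_hom.
have charts (sp : {ffun 'I_n.+1 -> T} * 'I_n.+1) :
    exists Q : {mpoly K[#|T|]}, Q != 0 /\ ((forall i, pr (sp.1 i) = i) ->
    forall (b : T -> K) (x : 'I_n.+1 -> K),
      x sp.2 = 1 -> (forall i, (G (sp.1 i)).@[x] != 0) ->
      (forall i, \sum_(t | pr t == i) b t * (G t).@[x] = 0) ->
      Q.@[b \o enum_val] = 0).
  have [/forallP prs|/forallP nprs] := boolP [forall i, pr (sp.1 i) == i].
    have [|Q Q_neq0 QE] := @chart_equation K n T pr G sp.1 sp.2; last by exists Q.
    by move=> i; apply/eqP/prs.
  (* A map that is no section of [pr] gives no chart and contributes a harmless factor 1. *)
  exists 1; split=> [|prs]; first exact: oner_neq0.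
  by case: nprs => i; apply/eqP.
have {charts} [Q QE] := fin_all_exists charts.
have [|b0] := @exists_meval_neq0 K _ (\prod_sp Q sp).
  by apply/prodf_neq0 => sp _; case: (QE sp).
rewrite rmorph_prod => /prodf_neq0 Qb0.
exists (b0 \o enum_rank) => x [p xp] x_sol.
(* If every fibre has an index whose form does not vanish at [x], these indices give a chart that
   [b0] avoids: a contradiction. *)
have [/forallP Gx|] :=
    boolP [forall i, exists t, (pr t == i) && ((G t).@[x] != 0)]; last first.
  rewrite negb_forall => /existsP[i /existsPn Gx]; exists i => t pr_t.
  by apply/eqP; have := Gx t; rewrite pr_t eqxx negbK.
have [s s_sel] := fin_all_exists (fun i => existsP (Gx i)).
(* Scaling x_p to 1 keeps the sums zero, since all forms in the fibre over [i] have the same degree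
   [d i]. *)
pose y i := (x p)^-1 * x i.
have yG t : (G t).@[y] = (x p) ^- d (pr t) * (G t).@[x].
  by rewrite (dhomog_meval_scale _ _ (G_hom t)) exprVn.
have /eqP[] := Qb0 (finfun s, p) isT.
rewrite /= -(@meval_eq _ _ (b0 \o enum_rank \o enum_val)) => [|k]; last first.
  by rewrite /= enum_valK.
apply: (proj2 (QE (finfun s, p)) _ _ y) => [i||i|i] /=; rewrite ?ffunE.
- by have /andP[/eqP] := s_sel i.
- by rewrite /y mulVf.
- have /andP[_ Gs] := s_sel i.
  by rewrite yG mulf_neq0 // invr_eq0 expf_neq0.
transitivity ((x p) ^- d i * (\sum_(t | pr t == i) (b0 \o enum_rank) t *: G t).@[x]).
  rewrite raddf_sum mulr_sumr; apply: eq_bigr => t /eqP <-.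
  by rewrite /= mevalZ mulrCA yG.
by rewrite x_sol mulr0.
Qed.

(** * Change of coefficient ring in integer polynomials and generic forms *)

Lemma feval_ext (S : comNzRingType) (T : finType) (P : fpoly int T)
    (u v : T -> S) :
  u =1 v -> feval P u = feval P v.
Proof. by move=> eq_uv; apply: meval_eq => k; apply: eq_uv. Qed.

Lemma fevalE (S : comNzRingType) (T : finType) (P : fpoly int T) (v : T -> S) :
  feval P v = \sum_(m : 'X_{1..#|{: T}| < msize P})
                (P@_m)%:~R * \prod_k v (enum_val k) ^+ m k.
Proof.
rewrite /feval (map_mpolyE _ (leqnn (msize P))) raddf_sum /=.
by apply: eq_bigr => m _; rewrite mevalZ mevalX.
Qed.

(** The coefficients of [P] are integers, which every ring morphism preserves. *)
Lemma feval_rmorph (S S' : comNzRingType) (phi : {rmorphism S -> S'})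
    (T : finType) (P : fpoly int T) (v : T -> S) :
  phi (feval P v) = feval P (phi \o v).
Proof.
rewrite !fevalE rmorph_sum /=; apply: eq_bigr => m _.
rewrite rmorphM rmorph_int rmorph_prod; congr (_ * _).
by apply: eq_bigr => i _; rewrite rmorphXn.
Qed.

Lemma dhomog_sum_expo (S : nzRingType) (N d : nat) (p : {mpoly S[N]}) :
  p \is d.-homog -> p = \sum_(s : expo N d) p@_(expo_mnm s) *: 'X_[expo_mnm s].
Proof.
move=> p_hom; apply/mpolyP => m; rewrite raddf_sum /=.
have [m_d|m_d] := eqVneq (mdeg m) d; last first.
  rewrite (dhomog_nemf_coeff p_hom m_d) big1 // => s _.
  rewrite mcoeffZ mcoeffX; case: eqP => [s_m|]; last by rewrite mulr0.
  by case/eqP: m_d; rewrite -s_m; apply/eqP/(valP s).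
have ltmd : (mdeg m < d.+1)%N by rewrite m_d.
pose s0 : expo N d := exist _ (BMultinom ltmd) (introT eqP m_d).
rewrite (bigD1 s0) //= mcoeffZ mcoeffX eqxx mulr1 big1 ?addr0 // => s neq_s.
rewrite mcoeffZ mcoeffX; case: eqP => [s_m|]; last by rewrite mulr0.
by case/eqP: neq_s; do 2!apply: val_inj.
Qed.

Lemma map_mpoly_map (A B C : nzRingType) (N : nat) (f : {additive A -> B})
    (g : {additive B -> C}) (p : {mpoly A[N]}) :
  map_mpoly g (map_mpoly f p) = map_mpoly (g \o f) p.
Proof. by apply/mpolyP => u; rewrite !mcoeff_map_mpoly. Qed.

Lemma eq_map_mpoly (A B : nzRingType) (N : nat) (f g : A -> B) (p : {mpoly A[N]}) :
  f =1 g -> map_mpoly f p = map_mpoly g p.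
Proof. by move=> eq_fg; apply: eq_bigr => m _; rewrite /= eq_fg. Qed.

Lemma map_mpoly_id (A : nzRingType) (N : nat) (p : {mpoly A[N]}) :
  map_mpoly id p = p.
Proof. by apply/mpolyP => u; rewrite (mcoeff_map_mpoly idfun). Qed.

Lemma map_mpoly_mpolyC (S S' : comNzRingType) (phi : {rmorphism S -> S'})
    (k N : nat) (p : {mpoly S[N]}) :
  map_mpoly (map_mpoly phi) (map_mpoly (@mpolyC k S) p)
    = map_mpoly (@mpolyC k S') (map_mpoly phi p).
Proof.
rewrite (map_mpoly_map phi (@mpolyC k S')).
rewrite (map_mpoly_map (@mpolyC k S) (map_mpoly phi)).
apply: eq_map_mpoly => c.
exact: map_mpolyC.
Qed.

Lemma map_generic_form (S S' : comNzRingType) (phi : {rmorphism S -> S'})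
    (N : nat) (I : finType) (d : I -> nat) (i : I) :
  map_mpoly (map_mpoly phi) (generic_form S N d i) = generic_form S' N d i.
Proof.
rewrite /generic_form rmorph_sum /=; apply: eq_bigr => s _.
by rewrite map_mpolyZ map_mpolyX /= map_mpolyX.
Qed.

Lemma meval_mpolyC (S : comNzRingType) (k N : nat) (v : 'I_k -> S)
    (p : {mpoly S[N]}) :
  map_mpoly (meval v) (map_mpoly (@mpolyC k S) p) = p.
Proof.
rewrite (map_mpoly_map (@mpolyC k S) (meval v)).
rewrite -[RHS]map_mpoly_id; apply: eq_map_mpoly => c.
exact: mevalC.
Qed.

Lemma meval_generic_form (S : comNzRingType) (N : nat) (I : finType)
    (d : I -> nat) (b : cname N d -> S) (i : I) :
  map_mpoly (meval (b \o enum_val)) (generic_form S N d i)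
    = \sum_(s : expo N (d i))
        b (Tagged (fun i => expo N (d i)) s) *: 'X_[expo_mnm s].
Proof.
rewrite /generic_form rmorph_sum /=; apply: eq_bigr => s _.
by rewrite map_mpolyZ map_mpolyX /= mevalXU /= enum_rankK.
Qed.

(** * Specialization of the polynomial in the b's *)

Lemma eq_res_comb (n m : nat) (kk : 'I_n.+1 -> 'I_m.+1 -> nat)
    (mm : 'I_n.+1 -> nat) (R : fpoly int (cname n.+1 mm)) (S : comNzRingType)
    (f g : 'I_m.+1 -> {mpoly S[n.+1]}) :
  f =1 g -> res_comb kk R f = res_comb kk R g.
Proof.
move=> eq_fg; apply: feval_ext => t; rewrite /coeffs.
suff -> : Acomb kk f (tag t) = Acomb kk g (tag t) by [].
by apply: eq_bigr => j _; rewrite eq_fg.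
Qed.

(** This lets the polynomial of any [f] be obtained from that of the generic forms over the
    integers. *)
Lemma res_comb_map (n m : nat) (kk : 'I_n.+1 -> 'I_m.+1 -> nat)
    (mm : 'I_n.+1 -> nat) (R : fpoly int (cname n.+1 mm))
    (S S' : comNzRingType) (phi : {rmorphism S -> S'})
    (f : 'I_m.+1 -> {mpoly S[n.+1]}) :
  map_mpoly phi (res_comb kk R f) = res_comb kk R (map_mpoly phi \o f).
Proof.
rewrite /res_comb feval_rmorph; apply: feval_ext => t /=.
rewrite /coeffs -mcoeff_map_mpoly; congr (_@__).
rewrite /Acomb rmorph_sum /=; apply: eq_bigr => j _.
by rewrite rmorphM /= /Aform map_generic_form map_mpoly_mpolyC.
Qed.

(** The cofactor of b_{i,j,s} in the [i]-th combination, which is linear in the b's: the shape that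
    [exists_generic_combination] handles. *)
Definition bform (n m : nat) (kk : 'I_n.+1 -> 'I_m.+1 -> nat)
    (S : comNzRingType) (f : 'I_m.+1 -> {mpoly S[n.+1]})
    (t : bname kk) : {mpoly S[n.+1]} :=
  'X_[expo_mnm (tagged t)] * f (tag t).2.

Definition bcomb (n m : nat) (kk : 'I_n.+1 -> 'I_m.+1 -> nat)
    (S : comNzRingType) (f : 'I_m.+1 -> {mpoly S[n.+1]})
    (b : bname kk -> S) (i : 'I_n.+1) : {mpoly S[n.+1]} :=
  \sum_(t | (tag t).1 == i) b t *: bform f t.

Lemma meval_res_comb (n m : nat) (kk : 'I_n.+1 -> 'I_m.+1 -> nat)
    (mm : 'I_n.+1 -> nat) (R : fpoly int (cname n.+1 mm))
    (S : comNzRingType) (f : 'I_m.+1 -> {mpoly S[n.+1]})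
    (b : bname kk -> S) :
  (res_comb kk R f).@[b \o enum_val] = feval R (coeffs mm (bcomb f b)).
Proof.
rewrite /res_comb [LHS]feval_rmorph; apply: feval_ext => t /=.
rewrite /coeffs -mcoeff_map_mpoly; congr (_@__); move: (tag t) => i {t}.
pose F ij (s : expo n.+1 (Adeg kk ij)) :=
  b (Tagged (fun ij => expo n.+1 (Adeg kk ij)) s)
    *: ('X_[expo_mnm s] * f ij.2).
(* A name is a triple (i, j, s); the sum over the names with [i] fixed is regrouped by [j], then by
   [s]. *)
transitivity (\sum_(ij | ij.1 == i) \sum_s F ij s); last first.
  by rewrite sig_big_dep /=; apply: eq_big => -[ij s] //=; rewrite andbT.
transitivity (\sum_(i' | i' == i) \sum_j \sum_s F (i', j) s); last first.
  by rewrite pair_big_dep /=; apply: eq_big => -[i' j] //=; rewrite andbT.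
rewrite big_pred1_eq /Acomb rmorph_sum /=; apply: eq_bigr => j _.
rewrite rmorphM /= /Aform meval_generic_form meval_mpolyC mulr_suml.
by apply: eq_bigr => s _; rewrite -scalerAl.
Qed.

Theorem theorem1 (K : closedFieldType) (n m : nat)
  (nn : 'I_m.+1 -> nat) (mm : 'I_n.+1 -> nat)
  (kk : 'I_n.+1 -> 'I_m.+1 -> nat)
  (mm_gt0 : forall i, (0 < mm i)%N)
  (kk_gt0 : forall i j, (0 < kk i j)%N)
  (mmE : forall i j, mm i = (kk i j + nn j)%N)
  (R : fpoly int (cname n.+1 mm)) (R_res : is_resultant R) :
  (forall f : 'I_m.+1 -> {mpoly K[n.+1]},
     (forall j, f j \is (nn j).-homog) ->
     (has_nonzero_solution f <-> res_comb kk R f = 0)) /\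
  is_system_of_resultants K (res_comb_coeffs kk R nn).
Proof.
have main (f : 'I_m.+1 -> {mpoly K[n.+1]}) :
    (forall j, f j \is (nn j).-homog) ->
    (has_nonzero_solution f <-> res_comb kk R f = 0).
  move=> f_hom.
  have bform_hom (t : bname kk) : bform f t \is (mm (tag t).1).-homog.
    rewrite (mmE _ (tag t).2) dhomogM // dhomogX.
    exact: valP (tagged t).
  have bcomb_hom (b : bname kk -> K) i : bcomb f b i \is (mm i).-homog.
    by apply: rpred_sum => t /eqP <-; apply: dhomogZ.
  have [_ resP] := R_res.
  split=> [[x [x_neq0 fx]]|res0].
    (* A common zero of the f_j is a zero of every combination, so the polynomial vanishes at each
       point of the b-space. *)
    apply/eqP/negPn/negP => /exists_meval_neq0[v] /eqP[].
    rewrite -(@meval_eq _ _ ((v \o enum_rank) \o enum_val)) => [|k]; last first.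
      by rewrite /= enum_valK.
    rewrite meval_res_comb; apply/(resP K _ (bcomb_hom _)).
    exists x; split=> // i; rewrite raddf_sum big1 // => t _.
    by rewrite /= mevalZ mevalM fx !mulr0.
  (* For this [b] the vanishing resultant yields a non-zero common zero [x] of the combinations; for
     some [i], all products x^s f_j with s of degree k_ij then vanish at [x]. *)
  have [b bP] := exists_generic_combination bform_hom.
  have /(resP K _ (bcomb_hom b))[x [x_neq0 bx]] : feval R (coeffs mm (bcomb f b)) = 0.
    by rewrite -meval_res_comb res0 meval0.
  have [i fx] := bP x x_neq0 bx.
  exists x; split=> // j; have [p xp] := x_neq0.
  (* The monomial x_p^(k_ij) is non-zero at [x], so f_j itself vanishes there. *)
  have s_deg : mdeg (U_(p) *+ kk i j)%MM = kk i j by rewrite mdegMn mdeg1 mul1n.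
  have lts : (mdeg (U_(p) *+ kk i j)%MM < (Adeg kk (i, j)).+1)%N by rewrite s_deg.
  pose s : expo n.+1 (Adeg kk (i, j)) := exist _ (BMultinom lts) (introT eqP s_deg).
  have /eqP := fx (Tagged (fun ij => expo n.+1 (Adeg kk ij)) s) erefl.
  rewrite mevalM mulf_eq0 /= => /orP[|/eqP//].
  by rewrite /expo_mnm /= -mpolyXn rmorphXn /= mevalXU expf_eq0 (negPf xp) andbF.
split=> // f f_hom; rewrite (main f f_hom).
pose v (k : 'I_#|{: cname n.+1 nn}|) := coeffs nn f (enum_val k).
(* [phi] specializes the a's to the coefficients of [f]. *)
pose phi := [the {rmorphism _ -> _} of meval v \o map_mpoly intr].
have -> : res_comb kk R f = map_mpoly phi (res_comb kk R (generic_form int n.+1 nn)).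
  rewrite res_comb_map; apply: eq_res_comb => j /=.
  rewrite [LHS](dhomog_sum_expo (f_hom j)) /generic_form rmorph_sum /=.
  apply: eq_bigr => s _; rewrite map_mpolyZ map_mpolyX /= map_mpolyX mevalXU.
  by rewrite /v enum_rankK.
rewrite /res_comb_coeffs; set P := res_comb _ _ _; split=> [P0 _ /mapP[u _ ->]|P0].
  by rewrite -[LHS]/(phi P@_u) -mcoeff_map_mpoly P0 mcoeff0.
apply/mpolyP => u; rewrite mcoeff_map_mpoly mcoeff0.
(* Coefficients outside the support are zero already over the integers, so the finite list
   suffices. *)
have [uP|/memN_msupp_eq0->] := boolP (u \in msupp P); last exact: rmorph0.
exact/P0/map_f.
Qed.
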